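(* Let $H<G$ be groups and $K$ a sofic group. Suppose $H<G$ is relatively sofic over $K$. Then $\ast_H G$ is sofic.
   Context: $H<G$ is relatively sofic over a group $K$ if there exist a sequence of inclusions of groups $(H_i<G_i)_{i\in\mathbb N}$ with all $G_i$ sofic and all $H_i$ amenable, a free ultrafilter $\omega$ on $\mathbb N$, and an embedding $\pi:G\to\prod_\omega(G_i\times K)$ into the algebraic ultraproduct such that $\pi(G)\cap\prod_\omega(H_i\times K)=\pi(H)$. The algebraic ultraproduct is $\prod_\omega L_i=(\prod_i L_i)/N$ with $N=\{(g_i):\{i:g_i=1\}\in\omega\}$. $\ast_H G$ denotes the amalgamated free product of countably infinitely many copies of $G$ over the common subgroup $H$. *)

(* Defs.v *)
From Stdlib Require Lists.List.
From mathcomp Require Import all_boot all_fingroup.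
From mathcomp Require Import boolp.
Set Implicit Arguments. Unset Strict Implicit. Unset Printing Implicit Defensive.

Record AbsGroup := {
  carrier :> Type;
  gmul : carrier -> carrier -> carrier;
  ginv : carrier -> carrier;
  gone : carrier;
  gmulA : forall x y z, gmul x (gmul y z) = gmul (gmul x y) z;
  gmul1 : forall x, gmul gone x = x;
  gmulV : forall x, gmul (ginv x) x = gone
}.

Definition is_subgroup (G : AbsGroup) (H : G -> Prop) : Prop :=
  H (gone G) /\ (forall x y, H x -> H y -> H (gmul x y)) /\
  (forall x, H x -> H (ginv x)).

Definition is_hom (G Q : AbsGroup) (f : G -> Q) : Prop :=
  forall x y, f (gmul x y) = gmul (f x) (f y).

Definition sofic (G : AbsGroup) : Prop :=
  forall (F : list G) (n : nat),
  exists (d : nat) (sigma : G -> {perm 'I_d}),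
    0 < d /\
    (forall g h, Stdlib.Lists.List.In g F -> Stdlib.Lists.List.In h F ->
       #|[set x : 'I_d | sigma (gmul g h) x != ((sigma g) * (sigma h))%g x]| * n.+1 <= d) /\
    (forall g, Stdlib.Lists.List.In g F -> g <> gone G ->
       #|[set x : 'I_d | sigma g x == x]| * n.+1 <= d).

(** Amenability of the subgroup H of G (as a discrete group), via the
    Følner condition: for every finite F ⊆ H and n there is a nonempty finite
    A ⊆ H (given as an injective a : 'I_k -> G) with |fA \ A| <= |A|/(n+1). *)
Definition amenable_subgroup (G : AbsGroup) (H : G -> Prop) : Prop :=
  forall (F : list G) (n : nat), (forall f, Stdlib.Lists.List.In f F -> H f) ->
  exists (k : nat) (a : 'I_k -> G),
    0 < k /\ injective a /\ (forall j, H (a j)) /\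
    (forall f, Stdlib.Lists.List.In f F ->
       #|[set j : 'I_k | ~~ `[< exists j', gmul f (a j) = a j' >]]| * n.+1 <= k).

Definition free_ultrafilter (U : (nat -> Prop) -> Prop) : Prop :=
  U (fun _ => True) /\ ~ U (fun _ => False) /\
  (forall A B : nat -> Prop, U A -> (forall i, A i -> B i) -> U B) /\
  (forall A B : nat -> Prop, U A -> U B -> U (fun i => A i /\ B i)) /\
  (forall A : nat -> Prop, U A \/ U (fun i => ~ A i)) /\
  (forall m : nat, ~ U (fun i => i = m)).

(** Relative soficity of H < G over K.  A map G -> prod_omega (G_i x K) into
    the algebraic ultraproduct is written out via a lift (p1 i, p2 i) : G -> G_i x K
    (every map into the ultraproduct has such a lift). *)
Definition rel_sofic_over (G : AbsGroup) (H : G -> Prop) (K : AbsGroup) : Prop :=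
  exists (Gs : nat -> AbsGroup) (Hs : forall i, Gs i -> Prop)
         (U : (nat -> Prop) -> Prop)
         (p1 : forall i, G -> Gs i) (p2 : nat -> G -> K),
    (forall i, sofic (Gs i)) /\
    (forall i, is_subgroup (Hs i)) /\
    (forall i, amenable_subgroup (Hs i)) /\
    free_ultrafilter U /\
    (forall g h, U (fun i => p1 i (gmul g h) = gmul (p1 i g) (p1 i h) /\
                            p2 i (gmul g h) = gmul (p2 i g) (p2 i h))) /\
    (forall g, g <> gone G -> U (fun i => p1 i g <> gone (Gs i) \/ p2 i g <> gone K)) /\
    (* pi(G) ∩ prod_omega (H_i x K) = pi(H) *)
    (forall g, U (fun i => Hs i (p1 i g)) <-> H g).

Definition is_amalg_free_power (G : AbsGroup) (H : G -> Prop) (P : AbsGroup)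
    (iota : nat -> G -> P) : Prop :=
  (forall n, is_hom (iota n)) /\
  (forall n m h, H h -> iota n h = iota m h) /\
  (forall (Q : AbsGroup) (phi : nat -> G -> Q),
     (forall n, is_hom (phi n)) ->
     (forall n m h, H h -> phi n h = phi m h) ->
     exists psi : P -> Q, is_hom psi /\ (forall n g, psi (iota n g) = phi n g) /\
       (forall psi' : P -> Q, is_hom psi' -> (forall n g, psi' (iota n g) = phi n g) ->
          forall x, psi' x = psi x)).

(* Main.v *)
(** Multiplication in ['S_d] is read as a right action, [x.g = sigma g x].

If G is sofic and H is amenable, take a Følner set A of H, a sofic approximation
V of G and a uniformly random order on V, and let the cell of v be the least
element of v.A.  Since h.A is close to A for h in H, the points v and v.h mostly
have the same cell, while for g outside H freeness makes v.A and (v.g).A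
disjoint, so that the cells differ.  Taking products with sofic approximations
of K, such finite "cellular" models of (G, H) exist as soon as H < G is
relatively sofic over K.

From a cellular model with cell map b, let the m-th copy of g act on V x Q by
(v, y) |-> (v.g, y t(m, b v) t(m, b (v.g))), where the t(m, c) are involutions
generating a finite quotient Q of their free product in which short reduced words
survive.  This is approximately multiplicative, elements of H act independently
of m, and a normal form g_1 ... g_k in distinct consecutive copies with all g_i
outside H either moves v or multiplies y by a nonempty reduced word.  The universal
property maps the amalgam to the group of sequences of such permutations modulo
asymptotic equality. *)
From Stdlib Require Lists.List.
Require Import Defs.
From mathcomp Require Import all_boot all_fingroup.
From mathcomp Require Import boolp.
From mathcomp Require Import zify.
Set Implicit Arguments. Unset Strict Implicit. Unset Printing Implicit Defensive.

Local Notation In := Stdlib.Lists.List.In.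
Local Notation "x ** y" := (gmul x y) (at level 40, left associativity).

(** * Groups and union bounds *)

Section AbsGroupTheory.
Variable G : AbsGroup.
Implicit Types x y z : G.

Lemma gmulI x y z : x ** y = x ** z -> y = z.
Proof. by move/(congr1 (gmul (ginv x))); rewrite !gmulA gmulV !gmul1. Qed.

Lemma gmulr1 x : x ** gone G = x.
Proof. by apply: (@gmulI (ginv x)); rewrite gmulA gmulV gmul1. Qed.

Lemma gmulrV x : x ** ginv x = gone G.
Proof. by apply: (@gmulI (ginv x)); rewrite gmulA gmulV gmul1 gmulr1. Qed.

Lemma gmulK x y : x ** y ** ginv y = x.
Proof. by rewrite -gmulA gmulrV gmulr1. Qed.

Lemma gmulVK x y : x ** ginv y ** y = x.
Proof. by rewrite -gmulA gmulV gmulr1. Qed.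

Lemma gmulKV x y : ginv x ** (x ** y) = y.
Proof. by rewrite gmulA gmulV gmul1. Qed.

Lemma ginv_eq x y : x ** y = gone G -> y = ginv x.
Proof. by move=> e; apply: (@gmulI x); rewrite gmulrV. Qed.

Lemma ginvM x y : ginv (x ** y) = ginv y ** ginv x.
Proof. by apply/esym/ginv_eq; rewrite gmulA gmulK gmulrV. Qed.

Lemma ginvK x : ginv (ginv x) = x.
Proof. by apply/esym/ginv_eq; rewrite gmulV. Qed.

Lemma ginv1 : ginv (gone G) = gone G.
Proof. by apply/esym/ginv_eq; rewrite gmul1. Qed.

Lemma gdiv_eq1 x y : x ** ginv y = gone G -> x = y.
Proof. by move=> e; rewrite -(gmulVK x y) e gmul1. Qed.

End AbsGroupTheory.

Lemma hom1 (G Q : AbsGroup) (f : G -> Q) : is_hom f -> f (gone G) = gone Q.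
Proof. by move=> fM; apply: (@gmulI _ (f (gone G))); rewrite -fM gmul1 gmulr1. Qed.

Lemma homV (G Q : AbsGroup) (f : G -> Q) x : is_hom f -> f (ginv x) = ginv (f x).
Proof. by move=> fM; apply: ginv_eq; rewrite -fM gmulrV hom1. Qed.

Lemma mem_In (T : eqType) (x : T) (s : seq T) : x \in s -> In x s.
Proof.
by elim: s => // y s IHs; rewrite inE => /orP[/eqP-> | /IHs ?]; [left | right].
Qed.

(** Since [n.*2.+2] is twice [n.+1], each set gets half of the allowance. This is why precision
    [n.*2.+1] is requested whenever two exceptional sets are merged. *)
Lemma cardsU_bound (T : finType) (A B : {set T}) n c :
  #|A| * (n.*2.+2) <= c -> #|B| * (n.*2.+2) <= c -> #|A :|: B| * n.+1 <= c.
Proof. by have [+ _] := leq_card_setU A B; set a := #|A|; set b := #|B|; set u := #|_|; nia. Qed.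

Lemma union_bound (I : Type) (T : finType) (s : seq I) (Bad : I -> {set T}) n c :
  (forall a, In a s -> #|Bad a| * (size s * n.+1).+1 <= c) ->
  exists2 B : {set T}, #|B| * n.+1 <= c &
    forall x, x \notin B -> forall a, In a s -> x \notin Bad a.
Proof.
move=> small.
have [B Bs Bx] : exists2 B : {set T}, #|B| * (size s * n.+1).+1 <= size s * c &
    forall x, x \notin B -> forall a, In a s -> x \notin Bad a.
  (* The weight is generalized so that it stays fixed while the list shrinks in the induction. *)
  move: (size s * n.+1).+1 small => N.
  elim: s => [|a s IHs] small; first by exists set0 => //; rewrite cards0.
  have [|B Bs Bx] := IHs; first by move=> b bs; apply: small; right.
  exists (Bad a :|: B).
    have [+ _] := leq_card_setU (Bad a) B; have := small a (or_introl (erefl a)).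
    by rewrite [size _]/=; nia.
  by move=> x; rewrite inE negb_or => /andP[xa /Bx xs] b [<- // | /xs].
exists B => //; move: Bs; case: (posnP (size s)) => [-> | s_gt0]; first by nia.
by rewrite -(leq_pmul2l s_gt0); nia.
Qed.

(** Distinct [g] and [h] separate [x] because [g ** ginv h] moves [x]: if [sigma g x = sigma h x],
    multiplicativity gives [sigma h (sigma (g ** ginv h) x) = sigma h x], and [sigma h] is
    injective. Hence the quotients are added to the test list [E]. *)
Lemma sofic_bad_set (G : AbsGroup) : sofic G -> forall (F : list G) (n : nat),
  exists (d : nat) (sigma : G -> {perm 'I_d}) (B : {set 'I_d}),
  [/\ 0 < d, #|B| * n.+1 <= d & forall x, x \notin B -> forall g h, In g F -> In h F ->
    [/\ sigma (g ** h) x = sigma h (sigma g x),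
        g <> gone G -> sigma g x <> x & g <> h -> sigma g x <> sigma h x]].
Proof.
move=> sG F n.
pose E := (F ++ List.map (fun p => p.1 ** ginv p.2) (List.list_prod F F))%list.
have FE g : In g F -> In g E by move=> gF; apply/List.in_app_iff; left.
have divE g h : In g F -> In h F -> In (g ** ginv h) E.
  move=> gF hF; apply/List.in_app_iff; right; apply/List.in_map_iff.
  by exists (g, h); split=> //; apply/List.in_prod_iff.
pose s := List.list_prod E E; pose N := size s * n.+1.
have [d [sigma [d_gt0 [multE freeE]]]] := sG E N.*2.+1.
pose bad (p : G * G) := [set x | sigma (p.1 ** p.2) x != (sigma p.1 * sigma p.2)%g x]
  :|: [set x | `[< p.1 <> gone G >] && (sigma p.1 x == x)].
have [[g h] /List.in_prod_iff[gE hE]| B Bs Bx] := @union_bound _ _ s bad n d.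
  apply: cardsU_bound; first exact: multE.
  case: asboolP => g1 /=; first exact: freeE.
  by rewrite (_ : [set _ | _] = set0) ?cards0 //; apply/setP=> x; rewrite !inE.
exists d, sigma, B; split=> // x xB.
have ok g h : In g E -> In h E ->
    sigma (g ** h) x = sigma h (sigma g x) /\ (g <> gone G -> sigma g x <> x).
  move=> gE hE; have /Bx : x \notin B by [].
  move=> /(_ (g, h)) /=; rewrite !inE negb_or negbK permM => /(_ _)/andP[].
    exact/List.in_prod_iff.
  move=> /eqP -> /nandP free; split=> // g1; case: free => [/asboolP // | /eqP //].
move=> g h gF hF; have [-> gfree] := ok g h (FE _ gF) (FE _ hF); split=> // gh egh.
have [] := ok (g ** ginv h) h (divE _ _ gF hF) (FE _ hF).
by rewrite gmulVK egh => /perm_inj e /(_ _ (esym e)); apply=> /gdiv_eq1.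
Qed.

Lemma fiber_bound (V W : finType) (P : V -> W -> bool) N :
  (forall v, #|[set w | P v w]| * N <= #|W|) ->
  #|[set p : V * W | P p.1 p.2]| * N <= #|{: V * W}|.
Proof.
move=> small; rewrite card_prod -sum1dep_card.
rewrite -(pair_big_dep xpredT P (fun _ _ => 1)) /= big_distrl /= -sum_nat_const.
by apply: leq_sum => v _; rewrite sum1dep_card.
Qed.

(** * Random cells from amenability *)

(* By symmetry each element of [S] is equally likely to get the least rank in a
   uniformly random order of the points. *)
Lemma argmin_bound d (S D : {set 'I_d}) c0 : c0 \in S ->
  #|[set p : {perm 'I_d} | [arg min_(c < c0 in S) p c] \in D]| * #|S|
    <= #|S :&: D| * #|{perm 'I_d}|.
Proof.
move=> c0S.
pose M c := [set p : {perm 'I_d} | [forall s in S, p c <= p s]].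
have M_le c c' : c \in S -> c' \in S -> #|M c| <= #|M c'|.
  move=> cS c'S; rewrite -(card_imset _ (mulgI (tperm c c'))).
  apply/subset_leq_card/subsetP=> _ /imsetP[p pM ->]; rewrite !inE in pM *.
  apply/forall_inP=> s sS; rewrite !permM tpermR.
  by move/forall_inP: pM; apply; case: tpermP => // ->.
have sumM : \sum_(c in S) #|M c| <= #|{perm 'I_d}|.
  under eq_bigr do rewrite -sum1_card.
  rewrite (exchange_big_dep predT) //= -sum1_card; apply: leq_sum => p _.
  rewrite sum1dep_card; case: (pickP [pred c in S | p \in M c]) => [c /andP[cS pc] | no]; last first.
    by rewrite (_ : [set _ | _] = set0) ?cards0 //; apply/setP=> c; have := no c; rewrite !inE /= => ->.
  rewrite -(cards1 c); apply/subset_leq_card/subsetP=> c'; rewrite !inE in pc * => /andP[c'S pc'].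
  apply/eqP/(@perm_inj _ p)/val_inj/eqP; rewrite eqn_leq.
  by rewrite (forall_inP pc _ c'S) (forall_inP pc' _ cS).
have M_bound c : c \in S -> #|M c| * #|S| <= #|{perm 'I_d}|.
  move=> cS; apply: leq_trans sumM; rewrite mulnC -sum_nat_const.
  by apply: leq_sum => c' c'S; apply: M_le.
apply: (@leq_trans ((\sum_(c in S :&: D) #|M c|) * #|S|)).
  rewrite leq_mul2r; apply/orP; right.
  under eq_bigr do rewrite -sum1_card.
  rewrite (exchange_big_dep predT) //= -sum1_card big_mkcond; apply: leq_sum => p _.
  rewrite inE; case: arg_minnP => // c cS cmin; case: ifP => // cD.
  rewrite (bigD1 c) //= ?inE ?cS ?cD //=.
  by apply/forall_inP=> s; apply: cmin.
by rewrite big_distrl -sum_nat_const; apply: leq_sum => c /setIP[/M_bound].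
Qed.

Section SkewPerm.
Variables (V W : finType) (s : {perm V}) (c : V -> {perm W}).
(** The fibre maps [c] are trivial on the space of random orders, independent of the base point for
    products with models of [K], and right translations depending on the cells for the amalgam. *)
Definition skew_fun (x : V * W) := (s x.1, c x.1 x.2).
Lemma skew_fun_inj : injective skew_fun.
Proof. by move=> [v w] [v' w'] [/perm_inj -> /perm_inj ->]. Qed.
Definition skew_perm := perm skew_fun_inj.
Lemma skew_permE x : skew_perm x = (s x.1, c x.1 x.2).
Proof. by rewrite permE. Qed.
End SkewPerm.

Lemma cardsXT (V W : finType) (B : {set V}) N :
  #|B| * N <= #|V| -> #|setX B [set: W]| * N <= #|{: V * W}|.
Proof. by rewrite cardsX cardsT card_prod; nia. Qed.

Lemma cardsTX (V W : finType) (B : {set W}) N :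
  #|B| * N <= #|W| -> #|setX [set: V] B| * N <= #|{: V * W}|.
Proof. by rewrite cardsX cardsT card_prod; nia. Qed.

(* The cells [b] are a finite model of the partition of [G] into cosets of [H]. *)
Definition cellular (G : AbsGroup) (H : G -> Prop) : Prop :=
  forall (F : list G) (n : nat),
  exists (V T : finType) (sigma : G -> {perm V}) (b : V -> T) (B : {set V}),
  [/\ 0 < #|V|, #|B| * n.+1 <= #|V| & forall x, x \notin B ->
    [/\ forall g h, In g F -> In h F -> sigma (g ** h) x = sigma h (sigma g x),
        forall g, In g F -> g <> gone G -> sigma g x <> x
      & forall g, In g F -> (H g <-> b (sigma g x) = b x)]].

Lemma leq_ratio_trans x k e w N : 0 < k -> x * k <= e * w -> e * N <= k -> x * N <= w.
Proof.
move=> k_gt0 xk eN; rewrite -(leq_pmul2l k_gt0).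
apply: (@leq_trans (e * w * N)); last by rewrite mulnAC leq_mul2r eN orbT.
by rewrite mulnA [k * x]mulnC leq_mul2r xk orbT.
Qed.

(** Each minimizer competes in the other set, so the two ranks bound each other, and ranks are
    distinct. *)
Lemma argmin_eq d (S S' : {set 'I_d}) c0 c0' (p : {perm 'I_d}) :
  c0 \in S -> c0' \in S' ->
  [arg min_(c < c0 in S) p c] \in S' -> [arg min_(c < c0' in S') p c] \in S ->
  [arg min_(c < c0 in S) p c] = [arg min_(c < c0' in S') p c].
Proof.
move=> c0S c0S'; case: arg_minnP => // c cS cmin cS'.
case: arg_minnP => // c' c'S' c'min c'S.
by apply/(@perm_inj _ p)/val_inj/eqP; rewrite eqn_leq cmin ?c'min.
Qed.

Lemma cellular_amenable (G : AbsGroup) (H : G -> Prop) :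
  sofic G -> is_subgroup H -> amenable_subgroup H -> cellular H.
Proof.
move=> sG [_ [HM HV]] amH F n.
pose FH := List.filter (fun g => `[< H g >]) F.
have FHP f : In f FH -> In f F /\ H f by move=> /List.filter_In[? /asboolP].
(* The union bound over [FH] at precision [n.*2.+1] needs weight [N.+1]. Each bad event there is
   covered by two escape events, so the Følner set is taken with weight [N.*2.+2]. *)
pose N := size FH * (n.*2.+2).
have [k [a [k_gt0 [a_inj [Ha foln]]]]] := amH FH N.*2.+1 (fun f fFH => (FHP f fFH).2).
pose As := List.map a (enum 'I_k).
have inAs j : In (a j) As by apply/List.in_map/mem_In; rewrite mem_enum.
(* With the products [g ** a j] in the list, a coincidence [sigma (a j') v = sigma (g ** a j) v] at
   a good point forces [a j' = g ** a j]. *)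
pose E := (F ++ As ++ List.map (fun p => p.1 ** p.2) (List.list_prod F As))%list.
have FE g : In g F -> In g E by move=> ?; apply/List.in_app_iff; left.
have AE j : In (a j) E.
  by apply/List.in_app_iff; right; apply/List.in_app_iff; left; exact: inAs.
have FAE g j : In g F -> In (g ** a j) E.
  move=> gF; do 2!(apply/List.in_app_iff; right); apply/List.in_map_iff.
  by exists (g, a j); split=> //; apply/List.in_prod_iff.
have [d [sigma [B0 [d_gt0 B0s good]]]] := sofic_bad_set sG E n.*2.+1.
pose j0 := Ordinal k_gt0.
pose S v := [set sigma (a j) v | j : 'I_k].
have inS v j : sigma (a j) v \in S v by apply/imsetP; exists j.
(* The second coordinate serves as the random order. The index [j0] only witnesses that [S x.1] is
   nonempty; since ranks are distinct, the minimizer does not depend on it. *)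
pose b (x : 'I_d * {perm 'I_d}) := [arg min_(c < sigma (a j0) x.1 in S x.1) x.2 c].
have bS x : b x \in S x.1 by rewrite /b; case: arg_minnP.
have S_shift v g j : v \notin B0 -> In g F -> sigma (a j) (sigma g v) = sigma (g ** a j) v.
  by move=> vB gF; have [] := good v vB g (a j) (FE _ gF) (AE _).
have cardS v : v \notin B0 -> #|S v| = k.
  move=> vB; rewrite card_imset ?card_ord // => i j eij.
  apply: contrapT => ij; have [_ _] := good v vB _ _ (AE i) (AE j).
  by apply=> // /a_inj.
have cardS' v g : v \notin B0 -> In g F -> #|S (sigma g v)| = k.
  move=> vB gF; rewrite card_imset ?card_ord // => i j; rewrite !S_shift // => eij.
  apply: contrapT => ij; have [_ _] := good v vB _ _ (FAE g i gF) (FAE g j gF).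
  by apply=> // /gmulI/a_inj.
(* If [f ** a j] is some [a j'], then the [j]-th point of [S (sigma f v)] is already in [S v]. The
   difference is thus covered by the image of the Følner exceptional indices. *)
have diffS v f : v \notin B0 -> In f FH -> #|S (sigma f v) :\: S v| * (N.*2.+2) <= k.
  move=> vB fFH; have [fF Hf] := FHP f fFH.
  apply: leq_trans (foln f fFH); rewrite leq_mul2r; apply/orP; right.
  set Z := [set j | _]; rewrite -(leq_add2r 0) !addn0.
  apply: leq_trans (leq_imset_card (fun j => sigma (a j) (sigma f v)) Z).
  apply/subset_leq_card/subsetP=> _ /setDP[/imsetP[j _ ->] notS].
  apply/imsetP; exists j => //; rewrite inE; apply/asboolP=> -[j' ej'].
  by move/negP: notS; apply; rewrite S_shift // ej'; apply: inS.
have diffS' v f : v \notin B0 -> In f FH -> #|S v :\: S (sigma f v)| * (N.*2.+2) <= k.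
  move=> vB fFH; have := diffS v f vB fFH; rewrite !cardsD (cardS _ vB).
  by rewrite (cardS' _ _ vB (FHP f fFH).1) setIC.
pose bad f := [set x : 'I_d * {perm 'I_d} |
  (x.1 \notin B0) && (b (sigma f x.1, x.2) != b (x.1, x.2))].
have [f fFH | B1 B1s B1x] := @union_bound _ _ FH bad n.*2.+1 #|{: 'I_d * {perm 'I_d}}|.
  apply: (@fiber_bound _ _ (fun v p => (v \notin B0) && (b (sigma f v, p) != b (v, p)))) => v.
  case: (boolP (v \notin B0)) => [vB | _] /=; last first.
    by rewrite (_ : [set _ | _] = set0) ?cards0 //; apply/setP=> x; rewrite !inE.
  (* The cells can differ only if one of the two minimizers lies outside the other set; by
     [argmin_bound] each case has probability at most a Følner ratio. *)
  pose M1 := [set p : {perm 'I_d} | b (v, p) \in ~: S (sigma f v)].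
  pose M2 := [set p : {perm 'I_d} | b (sigma f v, p) \in ~: S v].
  have fF := (FHP f fFH).1.
  apply: (@leq_trans (#|M1 :|: M2| * N.+1)).
    rewrite leq_mul2r; apply/orP; right; apply/subset_leq_card/subsetP=> p.
    rewrite !inE; apply: contraNT; rewrite negb_or !negbK => /andP[m1 m2].
    by apply/eqP/esym/argmin_eq.
  apply: cardsU_bound.
    apply: (leq_ratio_trans k_gt0 _ (diffS' v f vB fFH)).
    by have := argmin_bound (~: S (sigma f v)) (inS v j0); rewrite -setDE (cardS _ vB).
  apply: (leq_ratio_trans k_gt0 _ (diffS v f vB fFH)).
  by have := argmin_bound (~: S v) (inS (sigma f v) j0); rewrite -setDE (cardS' _ _ vB fF).
exists ('I_d * {perm 'I_d})%type, 'I_d.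
exists (fun g => skew_perm (sigma g) (fun _ => 1%g)), b, (setX B0 [set: _] :|: B1).
split.
- by apply/card_gt0P; exists (Ordinal d_gt0, 1%g).
- by apply: cardsU_bound => //; apply: cardsXT; rewrite card_ord.
move=> [v p]; rewrite !inE negb_or andbT /= => /andP[vB xB1]; split.
- move=> g h gF hF; rewrite !skew_permE /= !perm1.
  by have [->] := good v vB g h (FE _ gF) (FE _ hF).
- move=> g gF g1; rewrite skew_permE /= => -[e _].
  by have [_ free _] := good v vB g g (FE _ gF) (FE _ gF); apply: free.
move=> g gF; rewrite skew_permE /= perm1; split=> [Hg | eb].
  have : In g FH by apply/List.filter_In; split=> //; apply/asboolP.
  by move/(B1x _ xB1); rewrite inE /= vB /= negbK => /eqP.
(* A shared cell is a common point of [S v] and [S (sigma g v)], so [g] is a quotient of two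
   elements of the Følner set and lies in [H]. *)
have := bS (sigma g v, p); rewrite eb => /imsetP[j _].
have /imsetP[j' _ ->] := bS (v, p); rewrite S_shift // => e.
have [_ _ dist] := good v vB _ _ (AE j') (FAE g j gF).
have {dist e} : a j' = g ** a j by apply: contrapT => /dist.
by move=> e; rewrite -(gmulK g (a j)) -e; apply: HM => //; apply: HV.
Qed.

(** Finitely many conditions on [F] hold together at a single index [i]. The model is the product of
    a cellular model of [Hs i] in [Gs i] with a sofic model of [K]; cells ignore the [K] coordinate
    because membership in [H_i x K] does. *)
Lemma cellular_rel_sofic (G : AbsGroup) (H : G -> Prop) (K : AbsGroup) :
  sofic K -> rel_sofic_over H K -> cellular H.
Proof.
move=> sK [Gs [Hs [U [p1 [p2 [sGs [HsS [amHs [[UT [U0 [Usub [UI [Uc _]]]]]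
  [piM [pi_inj piH]]]]]]]]]]] F n.
have UIn (I : Type) (s : list I) (A : I -> nat -> Prop) :
    (forall a, In a s -> U (A a)) -> U (fun i => forall a, In a s -> A a i).
  elim: s => [|a s IHs] As; first exact: Usub UT _.
  have := UI _ _ (As a (or_introl erefl)) (IHs (fun c cs => As c (or_intror cs))).
  by move/Usub; apply=> i [Aa As'] c [<- | /As'].
have Uex A : U A -> exists i, A i.
  move=> UA; apply: contrapT => no; apply: U0; apply: Usub UA _ => i Ai; apply: no; by exists i.
have piH' g : U (fun i => Hs i (p1 i g) <-> H g).
  case: (pselect (H g)) => [Hg | nHg].
    by apply: Usub (proj2 (piH g) Hg) _.
  (* For [g] outside [H] the ultrafilter must contain the complement, which makes non-membership
     hold at most indices as well. *)
  have [/piH // | ] := Uc (fun i => Hs i (p1 i g)).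
  by move/Usub; apply=> i nH; split.
have pi_inj' g : U (fun i => g <> gone G -> p1 i g <> gone (Gs i) \/ p2 i g <> gone K).
  case: (pselect (g = gone G)) => [-> | g1]; first exact: Usub UT _.
  by apply: Usub (pi_inj g g1) _.
have /Uex[i [[iM iH] iJ]] := UI _ _ (UI _ _
  (@UIn _ (List.list_prod F F) _ (fun p _ => piM p.1 p.2))
  (@UIn _ F _ (fun g _ => piH' g))) (@UIn _ F _ (fun g _ => pi_inj' g)).
have [V [T [s1 [b [B1 [V_gt0 B1s good1]]]]]] :=
  cellular_amenable (sGs i) (HsS i) (amHs i) (List.map (p1 i) F) n.*2.+1.
have [d [s2 [B2 [d_gt0 B2s good2]]]] := sofic_bad_set sK (List.map (p2 i) F) n.*2.+1.
exists (V * 'I_d)%type, T, (fun g => skew_perm (s1 (p1 i g)) (fun _ => s2 (p2 i g))),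
  (fun x => b x.1), (setX B1 [set: _] :|: setX [set: _] B2).
split.
- by rewrite card_prod card_ord muln_gt0 V_gt0.
- by apply: cardsU_bound; [apply: cardsXT | apply: cardsTX; rewrite card_ord].
have inF1 g : In g F -> In (p1 i g) (List.map (p1 i) F) by exact: List.in_map.
have inF2 g : In g F -> In (p2 i g) (List.map (p2 i) F) by exact: List.in_map.
move=> [v w]; rewrite !inE negb_or andbT /= => /andP[vB wB].
have [M1 J1 C1] := good1 v vB.
split.
- move=> g h gF hF; rewrite !skew_permE /=.
  have [|/= -> ->] := iM (g, h); first exact/List.in_prod_iff.
  rewrite M1 //; try exact: inF1.
  by have [->] := good2 w wB _ _ (inF2 g gF) (inF2 h hF).
- move=> g gF g1; rewrite skew_permE /= => -[e1 e2].
  case: (iJ g gF g1) => [n1 | n2]; first by apply: J1 e1 => //; apply: inF1.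
  by have [_ free _] := good2 w wB _ _ (inF2 g gF) (inF2 g gF); apply: free.
move=> g gF; rewrite skew_permE /=; rewrite -C1; last exact: inF1.
by apply: iff_sym; apply: iH.
Qed.
(** * Approximating the amalgam by skew products *)

Section FreeInvolutions.
Variables (S : finType) (L : nat).

(* The free product of copies of Z/2 indexed by [S] acts on its reduced words by left
   multiplication; [toggle] truncates this action to words of length at most [L]. *)
Definition toggle (s : S) (w : seq S) : seq S :=
  if w is t :: w' then
    if t == s then (if ohead w' == Some s then w else w')
    else if size w < L then s :: w else w
  else if 0 < L then [:: s] else [::].

(** Two kinds of words are fixed: those beginning with [s] twice, and those of full length [L] with
    a head other than [s]. On the remaining words of length at most [L], adding and removing a
    leading [s] undo each other, so no reducedness condition has to be carried along. *)
Lemma toggleK s : {in [pred w | size w <= L], involutive (toggle s)}.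
Proof.
have ss : (Some s == Some s) = true by apply/eqP.
move=> [|t w] /=; first by case: ifP => L0 /=; rewrite ?eqxx ?L0.
rewrite inE => wL; case: (eqVneq t s) => [-> | nts]; last first.
  have ots : (Some t == Some s) = false by apply/eqP => -[/eqP]; apply/negP.
  case: ifP => tL /=; first by rewrite eqxx ots.
  by rewrite (negbTE nts) tL.
case: w wL => [|u w] /= wL; first by rewrite wL.
case: (eqVneq u s) => [-> | nus]; first by rewrite ss /= eqxx ss.
have -> /= : (Some u == Some s) = false by apply/eqP => -[/eqP]; apply/negP.
by rewrite (negbTE nus) wL.
Qed.

Lemma size_toggle s w : size w <= L -> size (toggle s w) <= L.
Proof.
case: w => [|t w] /= wL; first by case: ifP.
by case: ifP => _; case: ifP => //= _; apply: ltnW.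
Qed.

Definition toggle_bseq s (w : L.-bseq S) : L.-bseq S :=
  Bseq (size_toggle s (size_bseq w)).

Lemma toggle_bseqK s : involutive (toggle_bseq s).
Proof. by move=> w; apply/val_inj/toggleK/size_bseq. Qed.

Definition toggle_perm s : {perm L.-bseq S} := perm (inv_inj (toggle_bseqK s)).

Lemma toggle_perm2 s : (toggle_perm s * toggle_perm s = 1)%g.
Proof. by apply/permP=> w; rewrite !permE /= !permE toggle_bseqK. Qed.

(** Each new letter differs from the current head and the length bound leaves room, so every toggle
    prepends its letter. *)
Lemma toggle_word s w (u : L.-bseq S) : size w + size u <= L ->
  path (fun x y => x != y) s w -> ohead u = Some s ->
  val ((\prod_(t <- w) toggle_perm t)%g u) = rev w ++ u.
Proof.
elim: w s u => [|t w IHw] s u; first by rewrite big_nil perm1.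
rewrite /= addSnnS => uL /andP[st wp] us; rewrite big_cons permM.
have eu : val (toggle_perm t u) = t :: u.
  rewrite permE /=; case: (val u) us uL => [|x u'] //= [->].
  by rewrite (negbTE st) => /(leq_trans (leq_addl _ _))->.
by rewrite (IHw t) ?eu // rev_cons cat_rcons.
Qed.

(** The product moves the empty word, whose image has length [size w + 1]. *)
Lemma toggle_word_neq1 s w : size w < L -> path (fun x y => x != y) s w ->
  (\prod_(t <- s :: w) toggle_perm t)%g <> 1%g.
Proof.
move=> wL wp /permP/(_ [bseq]); rewrite big_cons permM perm1.
have L_gt0 : 0 < L by apply: leq_ltn_trans wL.
have e : val (toggle_perm s [bseq]) = [:: s] by rewrite permE /= L_gt0.
move/(congr1 val); rewrite (toggle_word _ wp) e ?addn1 //=.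
by move/(congr1 size); rewrite size_cat /= addn1.
Qed.
End FreeInvolutions.

(** [C] is the union of the preimages of [B] under the products of proper prefixes of [w]; each
    preimage has as many points as [B]. *)
Lemma path_prod_preimage (V : finType) (G : Type) (sigma : G -> {perm V})
    (B : {set V}) (w : seq (nat * G)) :
  exists2 C : {set V}, #|C| <= size w * #|B| &
    forall x, x \notin C -> forall w1 p w2, w = w1 ++ p :: w2 ->
      (\prod_(q <- w1) sigma q.2)%g x \notin B.
Proof.
elim: w => [|p w [C Cs CP]]; first by exists set0; rewrite ?cards0 // => x _ [].
exists (B :|: sigma p.2 @^-1: C).
  have [+ _] := leq_card_setU B (sigma p.2 @^-1: C).
  rewrite card_preimset ?mulSn; last exact: perm_inj.
  by move/leq_trans; apply; rewrite leq_add2l.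
move=> x; rewrite !inE negb_or => /andP[xB xC] [|p' w1] q w2 [e1 e2].
  by rewrite big_nil perm1.
by rewrite big_cons permM -e1; apply: CP e2.
Qed.

Definition alternating (G : AbsGroup) (H : G -> Prop) (w : seq (nat * G)) : Prop :=
  sorted (fun p q => p.1 != q.1) w /\ forall p, In p w -> ~ H p.2.

Definition few (X : finType) (P : pred X) n := #|[set x | P x]| * n.+1 <= #|X|.

(** The factor [size w] in the last clause accounts for one exceptional set per letter of the word;
    for a fixed word it is absorbed by enlarging [n]. *)
Definition approx_amalgam (G : AbsGroup) (H : G -> Prop) (F : list G) (n : nat)
    (X : finType) (rho : nat -> G -> {perm X}) : Prop :=
  0 < #|X| /\
  [/\ forall m g h, In g F -> In h F ->
        few (fun x => rho m (g ** h) x != (rho m g * rho m h)%g x) n,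
      forall m m' h, In h F -> H h -> few (fun x => rho m h x != rho m' h x) n,
      forall m g, In g F -> g <> gone G -> few (fun x => rho m g x == x) n
    & forall w, alternating H w -> w <> [::] -> size w <= n ->
        (forall p, In p w -> p.1 <= n /\ In p.2 F) ->
        #|[set x | (\prod_(p <- w) rho p.1 p.2)%g x == x]| * n.+1 <= size w * #|X|].

Definition mulr_perm (gT : finGroupType) (a : gT) : {perm gT} := perm (@mulIg _ a).

Lemma approx_amalgam_exists (G : AbsGroup) (H : G -> Prop) F n :
  cellular H -> exists (X : finType) (rho : nat -> G -> {perm X}),
    approx_amalgam H F n rho.
Proof.
move=> /(_ F n)[V [T [sigma [b [B [V_gt0 Bs good]]]]]].
(* Each letter of a word contributes two toggles, so words of size at most [n] need room for [n.*2]
   letters. The index type ['I_n.+1] covers the copies [m <= n]. *)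
pose gT := {perm n.*2.-bseq ('I_n.+1 * T)}.
pose tau m t : gT := toggle_perm n.*2 (inord m : 'I_n.+1, t).
have tau2 m t : (tau m t * tau m t = 1)%g by exact: toggle_perm2.
pose step m g v : gT := (tau m (b v) * tau m (b (sigma g v)))%g.
pose rho m g : {perm V * gT} := skew_perm (sigma g) (fun v => mulr_perm (step m g v)).
have rhoE m g x : rho m g x = (sigma g x.1, x.2 * step m g x.1)%g.
  by rewrite skew_permE permE.
have small (P : pred (V * gT)) : (forall x, x.1 \notin B -> ~~ P x) -> few P n.
  move=> PB; apply: leq_trans (cardsXT gT Bs).
  rewrite leq_mul2r; apply/orP; right; apply/subset_leq_card/subsetP=> x.
  by rewrite !inE andbT; apply: contraLR => /PB.
exists (V * gT)%type, rho; split.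
  by rewrite card_prod muln_gt0 V_gt0 /=; apply/card_gt0P; exists 1%g.
split.
- move=> m g h gF hF; apply: small => -[v y] /= /good[M _ _].
  rewrite negbK permM !rhoE /= M //; apply/eqP; congr pair.
  (* The two middle involutions, both attached to the cell of [sigma g v], cancel: [step] telescopes
     along the orbit. *)
  by rewrite /step M // !mulgA -[(y * _ * _ * _)%g]mulgA tau2 mulg1.
- move=> m m' h hF Hh; apply: small => -[v y] /= /good[_ _ C].
  by rewrite negbK !rhoE /= /step (proj1 (C h hF) Hh) !tau2.
- move=> m g gF g1; apply: small => -[v y] /= /good[_ J _].
  by rewrite rhoE; apply/eqP => -[/J e _]; apply: e.
move=> w [walt wH] w0 wn wF.
have [C Cs CP] := path_prod_preimage sigma B w.
have -> : size w * #|{: V * gT}| = size w * #|V| * #|{: gT}| by rewrite card_prod mulnA.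
apply: (@leq_trans (#|setX C [set: gT]| * n.+1)); last first.
  rewrite cardsX cardsT mulnAC leq_mul2r; apply/orP; right.
  apply: (@leq_trans (size w * #|B| * n.+1)); first by rewrite leq_mul2r Cs orbT.
  by rewrite -mulnA leq_mul2l Bs orbT.
rewrite leq_mul2r; apply/orP; right; apply/subset_leq_card/subsetP=> -[v y].
rewrite !inE andbT /=; apply: contraLR => vC.
pose letters := fix letters v (w : seq (nat * G)) : seq ('I_n.+1 * T) :=
  if w is p :: w' then
    [:: (inord p.1, b v), (inord p.1, b (sigma p.2 v)) & letters (sigma p.2 v) w']
  else [::].
have prodE u v' y' : (\prod_(p <- u) rho p.1 p.2)%g (v', y') =
    ((\prod_(p <- u) sigma p.2)%g v', y' * \prod_(t <- letters v' u) toggle_perm _ t)%g.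
  elim: u v' y' => [|p u IHu] v' y'; first by rewrite !big_nil !perm1 mulg1.
  by rewrite big_cons permM rhoE IHu /= !big_cons permM /step !mulgA.
(* The fibre coordinate suffices: cancelling [y] leaves the claim that the product of the toggles
   along [letters v w] is not 1. *)
apply/eqP; rewrite prodE => -[_].
rewrite -[RHS]mulg1 => /mulgI.
have size_letters v' u : size (letters v' u) = (size u).*2.
  by elim: u v' => //= p u IHu v'; rewrite IHu doubleS.
(* Within a syllable, adjacent letters differ in their cells because the group element is outside
   [H] and the point is good. Between syllables they differ in their copy indices, on which [inord]
   is injective since these are at most [n]. *)
have lpath v' p u : (forall u1 q u2, p :: u = u1 ++ q :: u2 ->
      (\prod_(t <- u1) sigma t.2)%g v' \notin B) ->
    (forall q, In q (p :: u) -> [/\ ~ H q.2, q.1 <= n & In q.2 F]) ->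
    path (fun p q => p.1 != q.1) p u ->
    path (fun x y => x != y) (inord p.1 : 'I_n.+1, b v')
      ((inord p.1, b (sigma p.2 v')) :: letters (sigma p.2 v') u).
  elim: u v' p => [|q u IHu] v' p gB pu.
    move=> _; rewrite /= andbT; apply/eqP => -[eb].
    have [nH _ pF] := pu p (or_introl erefl).
    have := gB [::] p [::] erefl; rewrite big_nil perm1 => /good[_ _ /(_ _ pF)[_]].
    by rewrite eb => /(_ erefl).
  move=> /= /andP[pq qu]; apply/and3P; split.
  - apply/eqP => -[eb].
    have [nH _ pF] := pu p (or_introl erefl).
    have := gB [::] p (q :: u) erefl; rewrite big_nil perm1 => /good[_ _ /(_ _ pF)[_]].
    by rewrite eb => /(_ erefl).
  - have [_ pn _] := pu p (or_introl erefl).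
    have [_ qn _] := pu q (or_intror (or_introl erefl)).
    by apply: contraNneq pq => -[/(congr1 val)]; rewrite /= !inordK ?ltnS // => ->.
  apply: IHu => //.
  - move=> u1 t u2 e; have := gB (p :: u1) t u2; rewrite big_cons permM; apply.
    by rewrite e.
  by move=> t tu; apply: pu; right.
case: w w0 walt wH wn wF vC CP Cs => // p w _ walt wH wn wF vC CP Cs.
apply: toggle_word_neq1; rewrite /= ?size_letters; first by move: wn => /=; lia.
apply: lpath => //; first by move=> u1 q u2; apply: CP.
by move=> q qw; have [] := wF q qw; have := wH q qw.
Qed.
(** * Normal forms in the amalgam *)

Lemma sval_inj (T : Type) (A : T -> Prop) : injective (@sval T A).
Proof. by move=> [x Ax] [y Ay] /= e; apply: eq_exist. Qed.

Section Quotient.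
Variables (R : AbsGroup) (N : R -> Prop).
Hypotheses (NG : is_subgroup N) (NJ : forall x y, N y -> N (ginv x ** y ** x)).

Let coset (r : R) : R -> Prop := fun s => N (ginv r ** s).

Let coset_eq r s : coset r = coset s <-> N (ginv r ** s).
Proof.
have [N1 [NM NV]] := NG; split=> [e | rs].
  by change (coset r s); rewrite e /coset gmulV.
apply/funext => t; apply/propext; rewrite /coset; split=> [rt | st].
  by have := NM _ _ (NV _ rs) rt; rewrite ginvM ginvK -!gmulA [r ** _]gmulA gmulrV gmul1.
by have := NM _ _ rs st; rewrite -!gmulA [s ** _]gmulA gmulrV gmul1.
Qed.

Let T := {S : R -> Prop | exists r, S = coset r}.
Let proj (r : R) : T := exist _ (coset r) (ex_intro _ r erefl).
Let repr (S : T) : R := sval (cid (svalP S)).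

Let projE r s : proj r = proj s <-> N (ginv r ** s).
Proof.
rewrite -coset_eq; split=> [/(congr1 sval) // | e].
exact/sval_inj.
Qed.

Let reprK S : proj (repr S) = S.
Proof. by apply: sval_inj; rewrite /= /repr; case: cid. Qed.

Let mul (S S' : T) := proj (repr S ** repr S').

Let projM r s : proj (r ** s) = mul (proj r) (proj s).
Proof.
have [N1 [NM NV]] := NG.
have /projE nr := reprK (proj r); have /projE ns := reprK (proj s).
apply/esym/projE; set r' := repr _ in nr *; set s' := repr _ in ns *.
(* The element [ginv s' ** ginv r' ** r ** s] is the conjugate of [ginv r' ** r] by [s'] times
   [ginv s' ** s]. *)
have := NM _ _ (NJ s' nr) ns.
by rewrite ginvM -!gmulA [s' ** _]gmulA gmulrV gmul1.
Qed.

(** Cosets are predicates, so extensionality turns equivalence into equality; operations use chosen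
    representatives, and [projM] transfers the group laws from [R]. *)
Lemma quotient_group_exists : exists (Q : AbsGroup) (pi : R -> Q),
  [/\ is_hom pi, forall q, exists r, pi r = q
    & forall r s, pi r = pi s <-> N (ginv r ** s)].
Proof.
have mulA S S' S'' : mul S (mul S' S'') = mul (mul S S') S''.
  by rewrite -(reprK S) -(reprK S') -(reprK S'') -!projM gmulA.
have mul1 S : mul (proj (gone R)) S = S by rewrite -(reprK S) -projM gmul1.
pose inv S := proj (ginv (repr S)).
have mulV S : mul (inv S) S = proj (gone R) by rewrite -{2}(reprK S) -projM gmulV.
by exists (Build_AbsGroup mulA mul1 mulV), proj; split=> // q; exists (repr q); exact: reprK.
Qed.
End Quotient.

Section Subgroup.
Variables (P : AbsGroup) (A : P -> Prop).
Hypothesis AG : is_subgroup A.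

Lemma subgroup_exists : exists (S : AbsGroup) (i : S -> P),
  [/\ is_hom i, injective i & forall x, A x <-> exists s, i s = x].
Proof.
have [A1 [AM AV]] := AG.
pose T := {x : P | A x}.
pose mul (x y : T) : T := exist A _ (AM _ _ (svalP x) (svalP y)).
pose inv (x : T) : T := exist A _ (AV _ (svalP x)).
have mulA x y z : mul x (mul y z) = mul (mul x y) z by apply/sval_inj/gmulA.
have mul1 x : mul (exist A _ A1) x = x by case: x => x Ax; apply/eq_exist/gmul1.
have mulV x : mul (inv x) x = exist A _ A1 by apply/sval_inj/gmulV.
exists (Build_AbsGroup mulA mul1 mulV), sval; split=> //.
  exact: sval_inj.
by move=> x; split=> [Ax | [[y Ay] <-]]; [exists (exist A x Ax) | exact: Ay].
Qed.
End Subgroup.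

Definition gword (G P : AbsGroup) (iota : nat -> G -> P) (w : seq (nat * G)) : P :=
  foldr (fun p x => iota p.1 p.2 ** x) (gone P) w.

Lemma gword_cat (G P : AbsGroup) (iota : nat -> G -> P) w w' :
  gword iota (w ++ w') = gword iota w ** gword iota w'.
Proof. by elim: w => [|p w IHw] /=; rewrite ?gmul1 // IHw gmulA. Qed.

Lemma gword_hom (G P Q : AbsGroup) (iota : nat -> G -> P) (f : P -> Q) w :
  is_hom f -> f (gword iota w) = gword (fun m g => f (iota m g)) w.
Proof. by move=> fM; elim: w => [|p w IHw] /=; rewrite ?hom1 // fM IHw. Qed.

Section Amalgam.
Variables (G : AbsGroup) (H : G -> Prop) (P : AbsGroup) (iota : nat -> G -> P).
Hypotheses (HG : is_subgroup H) (amalg : is_amalg_free_power H iota).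

(* The universal property retracts [P] onto the subgroup generated by the copies of [G]. *)
Lemma amalg_generated x : exists w, x = gword iota w.
Proof.
have [iM [iH univ]] := amalg.
have [|S [i [iS i_inj iP]]] := @subgroup_exists P (fun x => exists w, x = gword iota w).
  split; first by exists [::].
  split=> [_ _ [w ->] [w' ->] | _ [w ->]]; first by exists (w ++ w'); rewrite gword_cat.
  exists (rev (map (fun p => (p.1, ginv p.2)) w)).
  elim: w => [|p w IHw] /=; first by rewrite ginv1.
  by rewrite rev_cons -cats1 gword_cat -IHw /= gmulr1 ginvM (homV _ (iM _)).
have lift n g : exists s, i s = iota n g.
  by apply/iP; exists [:: (n, g)]; rewrite /= gmulr1.
have [phi phiE] := choice (fun p => lift p.1 p.2).
have [||psi [psiM [psiE _]]] := univ S (fun n g => phi (n, g)).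
- by move=> n g h; apply: i_inj; rewrite iS !phiE /= iM.
- by move=> n m h Hh; apply: i_inj; rewrite !phiE /=; apply: iH.
(* The identity and [i \o psi] agree on every copy of [G], so uniqueness identifies them and [x]
   lies in the image of [i]. *)
have [psi' [_ [_ uniq]]] := univ P iota iM iH.
have -> : x = i (psi x).
  transitivity (psi' x); first exact: (uniq id).
  apply/esym/(uniq (i \o psi)) => [y z | n g] /=; first by rewrite psiM iS.
  by rewrite psiE phiE.
by apply/iP; exists (psi x).
Qed.

(** Induction on a word for [x]. A prepended letter merges with the first syllable if it lies in [H]
    or has the same copy index; otherwise it starts a new syllable. *)
Lemma amalg_normal_form x : (exists2 h, H h & x = iota 0 h) \/
  exists w, [/\ w <> [::], alternating H w & x = gword iota w].
Proof.
have [iM [iH _]] := amalg; have [H1 [HM HV]] := HG.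
have alt1 n g : ~ H g -> alternating H [:: (n, g)].
  by move=> ng; split=> // p [<- | []].
have [w ->] := amalg_generated x; elim: w => [|[n g] w IHw] /=.
  by left; exists (gone G); rewrite ?hom1.
case: IHw => [[h Hh ->] | [[|[m k] u] [// _ [us uH] ->]]].
  rewrite (iH 0 n) // -iM; case: (pselect (H (g ** h))) => gh.
    by left; exists (g ** h); rewrite ?(iH 0 n).
  by right; exists [:: (n, g ** h)]; split=> //=; rewrite ?gmulr1 //; apply: alt1.
have nk : ~ H k by apply: (uH (m, k)); left.
have absorb h a : H h -> ~ H a -> ~ H (h ** a).
  by move=> Hh na /(HM _ _ (HV _ Hh)); rewrite gmulKV.
have swap a : ~ H a -> alternating H ((m, a) :: u).
  by move=> na; split; [case: (u) us | move=> p [<- // | pu]; apply: uH; right].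
case: (pselect (H g)) => Hg.
  right; exists ((m, g ** k) :: u); split=> //; first exact/swap/absorb.
  by rewrite /= (iH n m) // gmulA iM.
case: (eqVneq n m) => [-> | nm]; last first.
  right; exists [:: (n, g), (m, k) & u]; split=> //; split; first by rewrite /= nm.
  by move=> p [<- // | /uH].
rewrite /= gmulA -iM; case: (pselect (H (g ** k))) => [gk | ngk]; last first.
  by right; exists ((m, g ** k) :: u); split=> //; apply: swap.
case: u us uH {swap} => [|[m' k'] u] us uH /=.
  by left; exists (g ** k); rewrite // gmulr1 (iH 0 m).
(* The merged letter has fallen into [H], so it passes to copy [m'] and is absorbed by the next
   syllable, which stays outside [H]. *)
right; exists ((m', g ** k ** k') :: u); split=> //=; last by rewrite (iH m m') // gmulA -iM.
have nk' : ~ H k' by apply: (uH (m', k')); right; left.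
case/andP: us => _ us; split; first by case: (u) us.
by move=> p [<- | pu]; [apply: absorb | apply: uH; right; right].
Qed.
End Amalgam.

(** * The limit group *)

Lemma few_sub (X : finType) (P Q : pred X) n :
  (forall x, P x -> Q x) -> few Q n -> few P n.
Proof.
move=> PQ; apply: leq_trans; rewrite leq_mul2r; apply/orP; right.
by apply/subset_leq_card/subsetP=> x; rewrite !inE; apply: PQ.
Qed.

Lemma few_or (X : finType) (P Q : pred X) n :
  few P n.*2.+1 -> few Q n.*2.+1 -> few (fun x => P x || Q x) n.
Proof.
move=> fP fQ; have := cardsU_bound fP fQ.
by rewrite /few (_ : _ :|: _ = [set x | P x || Q x]) //; apply/setP=> x; rewrite !inE.
Qed.

Lemma few_perm (X : finType) (s : {perm X}) (P : pred X) n :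
  few P n -> few (fun x => P (s x)) n.
Proof.
rewrite /few -(card_preimset [set x | P x] (@perm_inj _ s)).
by rewrite (_ : _ @^-1: _ = [set x | P (s x)]) //; apply/setP=> x; rewrite !inE.
Qed.

Lemma few_mono (X : finType) (P : pred X) n m : n <= m -> few P m -> few P n.
Proof. by move=> nm; apply: leq_trans; rewrite leq_mul2l ltnS nm orbT. Qed.

Lemma sofic_finType (P : AbsGroup) :
  (forall (F : list P) n, exists (X : finType) (sigma : P -> {perm X}),
     [/\ 0 < #|X|, forall g h, In g F -> In h F ->
           few (fun x => sigma (g ** h) x != (sigma g * sigma h)%g x) n
       & forall g, In g F -> g <> gone P -> few (fun x => sigma g x == x) n]) ->
  sofic P.
Proof.
move=> fin F n; have [X [sigma [X_gt0 sM s1]]] := fin F n.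
have conj_inj g : injective (fun i : 'I_#|X| => enum_rank (sigma g (enum_val i))).
  by move=> i j /enum_rank_inj/perm_inj/enum_val_inj.
have cardE (A : {set 'I_#|X|}) (B : {set X}) :
    (forall i, (i \in A) = (enum_val i \in B)) -> #|A| = #|B|.
  move=> AB; rewrite -(card_imset A enum_val_inj); congr #|pred_of_set _|.
  apply/setP=> x; apply/imsetP/idP => [[i iA ->] | xB]; first by rewrite -AB.
  by exists (enum_rank x); rewrite ?AB enum_rankK.
exists #|X|, (fun g => perm (@conj_inj g)); split=> //; split=> [g h gF hF | g gF g1].
  rewrite (cardE _ [set x | sigma (g ** h) x != (sigma g * sigma h)%g x]); first exact: sM.
  by move=> i; rewrite !inE !permM !permE enum_rankK (inj_eq enum_rank_inj).
rewrite (cardE _ [set x | sigma g x == x]); first exact: s1.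
by move=> i; rewrite !inE permE -(inj_eq enum_val_inj) enum_rankK.
Qed.

Section PermProduct.
Variables (I : Type) (X : I -> finType).

Definition perm_prod_group : AbsGroup.
Proof.
refine (@Build_AbsGroup (forall i, {perm X i}) (fun r s i => (r i * s i)%g)
  (fun r i => (r i)^-1%g) (fun i => 1%g) _ _ _).
- by move=> r s t; apply: functional_extensionality_dep => i; rewrite mulgA.
- by move=> r; apply: functional_extensionality_dep => i; rewrite mul1g.
- by move=> r; apply: functional_extensionality_dep => i; rewrite mulVg.
Defined.
End PermProduct.

(** The filter of tails of the directed set of pairs (finite list, precision). Indexing by finite
    lists rather than by integers accommodates uncountable [G]. *)
Definition eventually (G : Type) (A : list G * nat -> Prop) : Prop :=
  exists F0 n0, forall F n, (forall g, In g F0 -> In g F) -> n0 <= n -> A (F, n).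

Lemma eventually_sub G (A B : list G * nat -> Prop) :
  (forall i, A i -> B i) -> eventually A -> eventually B.
Proof. by move=> AB [F0 [n0 AP]]; exists F0, n0 => F n ? ?; apply/AB/AP. Qed.

Lemma eventually_and G (A B : list G * nat -> Prop) :
  eventually A -> eventually B -> eventually (fun i => A i /\ B i).
Proof.
move=> [F0 [n0 AP]] [F1 [n1 BP]]; exists (F0 ++ F1)%list, (maxn n0 n1) => F n FF.
rewrite geq_max => /andP[n0n n1n].
by split; [apply: AP | apply: BP] => // g gF; apply/FF/List.in_app_iff; [left | right].
Qed.

Lemma eventually_all G (I : Type) (s : list I) (A : I -> list G * nat -> Prop) :
  (forall a, In a s -> eventually (A a)) -> eventually (fun i => forall a, In a s -> A a i).
Proof.
elim: s => [|a s IHs] As; first by exists [::], 0.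
have := eventually_and (As a (or_introl erefl)) (IHs (fun b bs => As b (or_intror bs))).
by apply: eventually_sub => i [Aa As'] b [<- | /As'].
Qed.

Lemma sofic_amalgam (G : AbsGroup) (H : G -> Prop) (P : AbsGroup) (iota : nat -> G -> P) :
  is_subgroup H -> cellular H -> is_amalg_free_power H iota -> sofic P.
Proof.
move=> HG cH amalg; have [iM [iH univ]] := amalg.
pose I := (list G * nat)%type.
have data (i : I) : {X : finType & {rho : nat -> G -> {perm X} | approx_amalgam H i.1 i.2 rho}}.
  by have [X /cid[rho ?]] := cid (@approx_amalgam_exists G H i.1 i.2 cH); exists X, rho.
pose X i := projT1 (data i); pose R := perm_prod_group X.
pose rho m g : R := fun i => sval (projT2 (data i)) m g.
have rhoP i : approx_amalgam H i.1 i.2 (fun m g => rho m g i) := svalP (projT2 (data i)).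
(* Asymptotic equality: the normalized Hamming distance tends to 0 along the directed set. *)
pose close (r s : R) := forall n, eventually (fun i => few (fun x => r i x != s i x) n).
have close_refl r : close r r.
  move=> n; exists [::], 0 => F m _ _.
  by rewrite /few (_ : [set _ | _] = set0) ?cards0 //; apply/setP=> x; rewrite !inE eqxx.
have close_sym r s : close r s -> close s r.
  by move=> rs n; apply: eventually_sub (rs n) => i; apply: few_sub => x; rewrite eq_sym.
have close_trans r s t : close r s -> close s t -> close r t.
  move=> rs st n; apply: eventually_sub (eventually_and (rs n.*2.+1) (st n.*2.+1)).
  move=> i [frs fst]; apply: few_sub (few_or frs fst) => x.
  by apply: contraNT; rewrite negb_or !negbK => /andP[/eqP->].
have close_mulr r s (t : R) : close r s -> close (r ** t) (s ** t).
  move=> rs n; apply: eventually_sub (rs n) => i; apply: few_sub => x.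
  by apply: contraNN => /eqP e; rewrite !permM e.
have close_mull r s (t : R) : close r s -> close (t ** r) (t ** s).
  move=> rs n; apply: eventually_sub (rs n) => i /(few_perm (t i)); apply: few_sub => x.
  by rewrite !permM.
pose N (r : R) := close r (gone R).
have NE r s : N (ginv r ** s) <-> close r s.
  split=> [/(close_mull _ _ r) | /(close_mull _ _ (ginv r))].
    by rewrite gmulA gmulrV gmul1 gmulr1; apply: close_sym.
  by rewrite gmulV; apply: close_sym.
have NG : is_subgroup N.
  split; first exact: close_refl.
  split=> [r s Nr Ns | r Nr].
    by apply: close_trans Ns; have := close_mulr _ _ s Nr; rewrite gmul1.
  by have := close_mull _ _ (ginv r) Nr; rewrite gmulV gmulr1; apply: close_sym.
have NJ (r s : R) : N s -> N (ginv r ** s ** r).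
  move=> Ns; have := close_mulr _ _ r (close_mull _ _ (ginv r) Ns).
  by rewrite gmulr1 gmulV.
have [Q [pi [piM pi_surj piE]]] := quotient_group_exists NG NJ.
have {}piE r s : pi r = pi s <-> close r s by rewrite piE NE.
have [||psi [psiM [psiE _]]] := univ Q (fun m g => pi (rho m g)).
- move=> m g h; rewrite -piM; apply/piE => n.
  exists [:: g; h], n => F k FF nk; have [_ [M _ _ _]] := rhoP (F, k).
  by apply: few_mono nk _; apply: M; apply: FF; [left | right; left].
- move=> m m' h Hh; apply/piE => n.
  exists [:: h], n => F k FF nk; have [_ [_ M _ _]] := rhoP (F, k).
  by apply: few_mono nk _; apply: M => //; apply: FF; left.
(* A set-theoretic lift of [psi] to families of permutations; it is multiplicative only up to
   [close], which is what soficity asks for. *)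
have [lift liftE] := choice (fun x => pi_surj (psi x)).
have liftM x y : close (lift (x ** y)) (lift x ** lift y).
  by apply/piE; rewrite piM !liftE psiM.
have lift_free x n : x <> gone P -> eventually (fun i => few (fun y => lift x i y == y) n).
  (* A point fixed by [lift x] is fixed by [r] or is one where [r] and [lift x] disagree, so
     freeness can be checked on any close [r], given by the normal form of [x]. *)
  move=> x1; suff [r lr fr] : exists2 r : R, close (lift x) r &
      eventually (fun i => few (fun y => r i y == y) n.*2.+1).
    apply: eventually_sub (eventually_and (lr n.*2.+1) fr) => i [f1 f2].
    apply: few_sub (few_or f1 f2) => y /eqP e;
    by rewrite e [_ == y]eq_sym orNb.
  have [[h Hh ex] | [w [w0 walt ex]]] := amalg_normal_form HG amalg x.
    exists (rho 0 h); first by apply/piE; rewrite liftE ex psiE.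
    exists [:: h], n.*2.+1 => F k FF nk; have [_ [_ _ M _]] := rhoP (F, k).
    apply: few_mono nk _; apply: M; first by apply: FF; left.
    by move=> h1; apply: x1; rewrite ex h1 hom1.
  exists (gword rho w).
    apply/piE; rewrite liftE ex !gword_hom //; congr foldr; apply/funext => p.
    by apply/funext => y; rewrite psiE.
  have gwordE i : gword rho w i = (\prod_(p <- w) rho p.1 p.2 i)%g.
    by elim: (w) => [|p u IHu] /=; rewrite ?big_nil // big_cons -IHu.
  pose top := \max_(p <- w) p.1.
  (* The term [top] bounds the copy indices in [w]; the other term outweighs the factor [size w] in
     the word bound and leaves precision [n.*2.+2]. *)
  exists (List.map snd w), (top + size w * n.*2.+2) => F k FF nk.
  have [_ [_ _ _ M]] := rhoP (F, k).
  have := M w walt w0 _ _; rewrite /few gwordE /= => {}M.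
  have wn : size w * n.*2.+2 <= k by apply: leq_trans nk; rewrite leq_addl.
  have w_gt0 : 0 < size w by case: (w) w0.
  have {}M := M _ _; rewrite -(leq_pmul2l w_gt0).
  apply: leq_trans (M _ _); first by nia.
    by nia.
  move=> p pw; split; last by apply/FF/List.in_map.
  apply: leq_trans (leq_trans (leq_addr _ _) nk); rewrite /top.
  elim: (w) pw => // q u IHu [-> | /IHu]; rewrite big_cons leq_max ?leqnn // => ->.
  by rewrite orbT.
apply: sofic_finType => F n.
(* Only finitely many conditions concern [F], so the single threshold index [(F0, n0)] already gives
   the required model. *)
have [F0 [n0 ev]] := eventually_and
  (eventually_all (s := List.list_prod F F) (fun p _ => liftM p.1 p.2 n))
  (eventually_all (s := List.filter (fun x => `[< x <> gone P >]) F)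
    (fun x xF => lift_free x n (asboolW (proj2 (proj1 (List.filter_In _ _ _) xF))))).
have [] := ev F0 n0 (fun _ => id) (leqnn _); set i := (F0, n0) => evM ev1.
exists (X i), (fun x => lift x i); split=> [|x y xF yF | x xF x1].
- by have [] := rhoP i.
- by apply: (evM (x, y)); apply/List.in_prod_iff.
by apply: ev1; apply/List.filter_In; split=> //; apply/asboolP.
Qed.

Theorem theorem2p7 (G : AbsGroup) (H : G -> Prop) (K : AbsGroup) :
  is_subgroup H -> sofic K -> rel_sofic_over H K ->
  forall (P : AbsGroup) (iota : nat -> G -> P),
    is_amalg_free_power H iota -> sofic P.
Proof.
move=> HG sK rel P iota; apply: sofic_amalgam => //; exact: cellular_rel_sofic rel.
Qed.
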